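(* Let $V$ and $\widetilde V$ be finite-dimensional real inner product spaces, let $A\colon V\to V$ be symmetric positive semidefinite with $A\neq 0$, let $f\in\mathcal R(A)$, let $\Pi\colon\widetilde V\to V$ be a surjective linear operator, let $\widetilde B\colon\widetilde V\to\widetilde V$ be a linear operator, and set $\widetilde A=\Pi^tA\Pi$ and $B=\Pi\widetilde B\Pi^t$. Let $\widetilde W$ be a subspace of $\widetilde V$ with $\widetilde W\supset\mathcal R(\widetilde A)$ and let $\widetilde Q\colon\widetilde V\to\widetilde W$ be the orthogonal projection onto $\widetilde W$. If the symmetrized operator $$\widetilde{\bar B}_{\widetilde Q}=\widetilde Q(\widetilde B+\widetilde B^t-\widetilde B^t\widetilde A\widetilde B)\widetilde Q^t\colon\widetilde W\to\widetilde W$$ is SPD, then the iterative method $u^{m+1}=u^m+B(f-Au^m)$, $m\ge0$, for solving $Au=f$ converges, and $$|I-BA|_A^2=1-\left(\sup_{v\in\mathcal R(A),\ |v|_A=1}\ \inf_{\phi\in\mathcal N(A)}\ \inf_{\tilde v\in\widetilde W,\ \Pi\tilde v=v+\phi}(\widetilde{\bar B}_{\widetilde Q}^{-1}\tilde v,\tilde v)\right)^{-1}.$$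
   Context: All inner products are denoted $(\cdot,\cdot)$; $T^t$ is the adjoint, $\mathcal N(T)$ the null space, $\mathcal R(T)$ the range of a linear operator $T$. $\widetilde Q^t\colon\widetilde W\to\widetilde V$ is the natural embedding. A symmetric operator $T$ is SPD if $(Tv,v)>0$ for all $v\ne0$, and symmetric positive semidefinite (semi-SPD) if $(Tv,v)\ge 0$ for all $v$. For semi-SPD $T$, $|v|_T=(Tv,v)^{1/2}$, and for a linear operator $S$, $|S|_T=\sup_{|v|_T=1}|Sv|_T$. Convergence of an iterative method $\{u^m\}$ for the semi-SPD system $Au=f$ means: $Qu^m\to Qu$ for every initial guess $u^0\in V$, where $Q$ is the orthogonal projection of $V$ onto $\mathcal R(A)$ and $u$ is any solution of $Au=f$. The infimum over an empty set is $+\infty$. *)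

(* Defs.v *)
From HB Require Import structures.
From mathcomp Require Import all_boot all_order all_algebra.
From mathcomp Require Import all_classical all_reals all_analysis.

Set Implicit Arguments.
Unset Strict Implicit.
Unset Printing Implicit Defensive.

Import Order.TTheory GRing.Theory Num.Theory.
Import numFieldNormedType.Exports.

Local Open Scope classical_set_scope.
Local Open Scope ring_scope.

(* A finite-dimensional real inner product space is a vectType over a realType
   with a form ip : {dot V for idfun}, i.e. a positive definite symmetric
   bilinear form. *)

Section InnerProductTheory.
Variables (R : realType) (V : vectType R) (ip : {dot V for idfun}).

Lemma dotC u v : ip u v = ip v u.
Proof. by rewrite hermC /= expr0 mul1r. Qed.

Lemma dotDl u v w : ip (u + v) w = ip u w + ip v w.
Proof. exact: linearDl. Qed.

Lemma dotZl a u w : ip (a *: u) w = a * ip u w.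
Proof. exact: linearZl_LR. Qed.

Lemma dotBl u v w : ip (u - v) w = ip u w - ip v w.
Proof. exact: linearBl. Qed.

Lemma dotDr w u v : ip w (u + v) = ip w u + ip w v.
Proof. exact: linearDr. Qed.

Lemma dotZr w a u : ip w (a *: u) = a * ip w u.
Proof. exact: linearZr_LR. Qed.

Lemma dotBr w u v : ip w (u - v) = ip w u - ip w v.
Proof. exact: linearBr. Qed.

Lemma dot_coordl n (a : 'I_n -> R) (b : 'I_n -> V) w :
  ip (\sum_i a i *: b i) w = \sum_i a i * ip (b i) w.
Proof.
elim/big_ind2: _ => [|x1 x2 y1 y2 <- <-|i _]; [exact: linear0l|exact: dotDl|].
exact: dotZl.
Qed.

Lemma dot_eq0 u : ip u u = 0 -> u = 0.
Proof.
move=> u0; apply/eqP/negPn/negP => /(@neq0_dnorm_gt0 _ _ _ ip).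
by rewrite u0 ltxx.
Qed.

Lemma dot_inj u v : (forall w, ip w u = ip w v) -> u = v.
Proof.
move=> uv; apply/eqP; rewrite -subr_eq0; apply/eqP/dot_eq0.
by rewrite dotBr uv subrr.
Qed.

Lemma riesz (l : {linear V -> R^o}) : exists w, forall u, l u = ip u w.
Proof.
pose b := vbasis {:V}.
pose phi w : 'rV[R]_(\dim {:V}) := \row_i ip b`_i w.
have phi_lin : linear phi.
  by move=> a u v; apply/rowP => i; rewrite !mxE dotDr dotZr.
pose phil := HB.pack_for {linear V -> 'rV[R]_(\dim {:V})} phi
  (GRing.isLinear.Build _ _ _ _ _ phi_lin).
have ker0 : lker (linfun phil) == 0%VS.
  apply/lker0P => u v; rewrite !lfunE /= => /rowP uv.
  apply: dot_inj => w; rewrite (coord_vbasis (memvf w)) !dot_coordl.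
  apply: eq_bigr => i _; congr (_ * _).
  by have := uv i; rewrite !mxE => ->.
have img : limg (linfun phil) = fullv.
  apply/eqP; rewrite eqEdim subvf /= limg_dim_eq; last first.
    by rewrite (eqP ker0) capv0.
  by rewrite !dimvf /dim /= mul1n.
have /memv_imgP[w _ ew] : (\row_i l b`_i) \in limg (linfun phil).
  by rewrite img memvf.
exists w => u; rewrite (coord_vbasis (memvf u)) linear_sum dot_coordl.
apply: eq_bigr => i _; rewrite linearZ /=; congr (_ * _).
by move: ew => /rowP/(_ i); rewrite lfunE !mxE.
Qed.

End InnerProductTheory.

Section Adjoint.
Variables (R : realType) (U V : vectType R).
Variables (ipU : {dot U for idfun}) (ipV : {dot V for idfun}).

(* The unique operator satisfying the defining identity, which exists by
   adjointP. *)
Definition adjoint (T : 'Hom(U, V)) : 'Hom(V, U) :=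
  xget 0 [set S : 'Hom(V, U) | forall u v, ipV (T u) v = ipU u (S v)].

Lemma adjointP (T : 'Hom(U, V)) u v : ipV (T u) v = ipU u (adjoint T v).
Proof.
rewrite /adjoint; case: xgetP => [S _|noS]; first exact.
exfalso.
have ex v' : exists w, forall u, ipV (T u) v' = ipU u w.
  have lin : linear (fun u => ipV (T u) v' : R^o).
    by move=> a x y; rewrite linearP dotDl dotZl.
  exact: (riesz ipU (HB.pack_for {linear U -> R^o} (fun u => ipV (T u) v' : R^o)
    (GRing.isLinear.Build _ _ _ _ _ lin))).
have [S SP] := choice ex.
have Slin : linear S.
  move=> a x y; apply: (dot_inj (ip := ipU)) => w.
  by rewrite -SP !dotDr !dotZr -!SP.
pose Sl := HB.pack_for {linear V -> U} S (GRing.isLinear.Build _ _ _ _ _ Slin).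
by apply: (noS (linfun Sl)) => x y; rewrite lfunE /= SP.
Qed.

End Adjoint.

Section SubspaceInnerProduct.
Variables (R : realType) (V : vectType R) (ip : {dot V for idfun}).
Variable W : {vspace V}.

Definition subdot (u v : subvs_of W) : R := ip (vsval u) (vsval v).

Fact subdot_bilinear : bilinear_for
  (GRing.Scale.Law.clone _ _ ( *%R ) _)
  (GRing.Scale.Law.clone _ _ (idfun \; *%R ) _) subdot.
Proof.
split=> [w|w] a x y; rewrite /subdot (linearP vsval).
  by rewrite dotDl dotZl.
by rewrite dotDr dotZr.
Qed.

HB.instance Definition _ := bilinear_isBilinear.Build R _ _ _
  (GRing.Scale.Law.clone _ _ ( *%R ) _)
  (GRing.Scale.Law.clone _ _ (idfun \; *%R ) _) subdot subdot_bilinear.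

Fact subdot_sym x y : subdot x y = (-1) ^+ false * idfun (subdot y x).
Proof. exact: hermC. Qed.

HB.instance Definition _ :=
  isHermitianSesquilinear.Build R _ false idfun subdot subdot_sym.

Fact subdot_gt0 u : u != 0 -> 0 < subdot u u.
Proof. by move=> u0; apply: neq0_dnorm_gt0. Qed.

HB.instance Definition _ := isDotProduct.Build R _ subdot subdot_gt0.

Definition embed : 'Hom(subvs_of W, V) := linfun vsval.

(* The orthogonal projection of V onto W, with codomain W: the projection onto
   W along its orthogonal complement. *)
Definition oproj : 'Hom(V, subvs_of W) :=
  (linfun (vsproj W) \o daddv_pi W (orthov ip W))%VF.

Lemma capv_orthov : (W :&: orthov ip W = 0)%VS.
Proof.
apply/eqP; rewrite -subv0; apply/subvP => u.
rewrite memv_cap memv0 => /andP[uW /mem_orthovP/(_ _ uW)] uu.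
by apply/eqP/(dot_eq0 uu).
Qed.

Lemma oproj_orth v w : w \in W -> ip (v - vsval (oproj v)) w = 0.
Proof.
move=> wW; pose e := adjoint (subdot : {dot _ for idfun}) ip embed v.
have eP x : x \in W -> ip (v - vsval e) x = 0.
  move=> xW; have := adjointP (subdot : {dot _ for idfun}) ip embed (vsproj W x) v.
  rewrite lfunE /= /subdot vsprojK// => h.
  by rewrite dotC dotBr h subrr.
have vD : v = vsval e + (v - vsval e) by rewrite addrC subrK.
have oe : v - vsval e \in orthov ip W by apply/mem_orthovP.
have vW : v \in (W + orthov ip W)%VS by rewrite vD memv_add ?subvsP.
have pe : daddv_pi W (orthov ip W) v + daddv_pi (orthov ip W) W v = v.
  exact: daddv_pi_add capv_orthov vW.
rewrite comp_lfunE lfunE /= vsprojK; last exact: memv_pi.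
set p := daddv_pi W _ v in pe *; have -> : v - p = daddv_pi (orthov ip W) W v.
  by apply/eqP; rewrite subr_eq addrC pe.
exact: (mem_orthovP (memv_pi (orthov ip W) W v)).
Qed.

Lemma adjoint_oproj : adjoint ip subdot oproj = embed.
Proof.
apply/lfunP => w; apply: (dot_inj (ip := ip)) => v; rewrite -adjointP.
have -> : embed w = vsval w by rewrite lfunE.
have /eqP := oproj_orth v (subvsP w).
by rewrite dotBl subr_eq0 => /eqP ->.
Qed.

End SubspaceInnerProduct.

Arguments subdot {R V} ip W u v.
Arguments embed {R V} W.

Section Operators.
Variables (R : realType) (V : vectType R) (ip : {dot V for idfun}).
Implicit Types (T S A B : 'End(V)).

Definition self_adjoint T := adjoint ip ip T = T.

Definition SPD T := self_adjoint T /\ forall v, v != 0 -> 0 < ip (T v) v.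

Definition semiSPD T := self_adjoint T /\ forall v, 0 <= ip (T v) v.

Definition dotnorm v : R := Num.sqrt (ip v v).

Definition seminorm T v : R := Num.sqrt (ip (T v) v).

(* The supremum is taken in the extended reals, so that no boundedness is
   presupposed. *)
Definition opseminorm T S : \bar R :=
  ereal_sup [set (seminorm T (S v))%:E | v in [set v | seminorm T v = 1]].

Definition iterate A B (f u0 : V) (m : nat) : V :=
  iter m (fun u => u + B (f - A u)) u0.

(* it u0 m is the m-th iterate of the method started at u0. The convergence
   Q (it u0 m) --> Q u is that of the norm of the inner product space V. *)
Definition converges A (f : V) (it : V -> nat -> V) :=
  forall u0 u, A u = f ->
  dotnorm (vsval (oproj ip (limg A) (it u0 m))
    - vsval (oproj ip (limg A) u)) @[m --> \oo] --> (0 : R).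

Lemma SPD_compfV T : SPD T -> (T \o T^-1 = \1)%VF.
Proof.
move=> [_ T_gt0]; apply: lker0_compfV; rewrite -subv0; apply/subvP => v.
rewrite memv_ker memv0; apply: contraTT => /T_gt0; apply: contraTN => /eqP->.
by rewrite linear0l ltxx.
Qed.

End Operators.

(* Main.v *)
(* Write P for the restriction of Pi to W~, P' for its adjoint, C for the
   symmetrized operator and g(v) = (C P' A v, P' A v). Since R(Pi^t A) lies in
   W~, one has |(I - BA) v|_A^2 = |v|_A^2 - g(v), so everything rests on
   comparing the constant K of the identity with the infimum of g over the
   A-unit sphere. If A P w = A v then |v|_A^4 <= (C^-1 w, w) g(v) by
   Cauchy-Schwarz, whence g >= 1/K on the sphere. Conversely, if g >= l |.|_A^2,
   choose z with A P C P' A z = A v and w = C P' A z: then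
   g(z) = (C^-1 w, w) = (A v, z) <= |v|_A |z|_A <= |v|_A (g(z) / l)^(1/2),
   whence K <= 1/l. Coercivity of A P C P' A on R(A) makes the infimum of g
   positive, so that I - BA contracts the A-seminorm, which is a norm on
   R(A). *)

Require Import Defs.
From mathcomp Require Import all_boot all_order all_algebra.
From mathcomp Require Import all_classical all_reals all_analysis.
From mathcomp Require Import ring lra.
Set Implicit Arguments.
Unset Strict Implicit.
Unset Printing Implicit Defensive.

Import Order.TTheory GRing.Theory Num.Theory.
Import numFieldNormedType.Exports.
Local Open Scope classical_set_scope.
Local Open Scope ring_scope.

(** * Cauchy-Schwarz, boundedness and coercivity for quadratic forms of operators *)

Section SymmetricOperators.
Context {R : realType} {V : vectType R} (ip : {dot V for idfun}).
Implicit Types (T : 'End(V)) (x y : V).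

Lemma self_adjointE T x y : self_adjoint ip T -> ip (T x) y = ip x (T y).
Proof. by move=> Tsa; rewrite (adjointP ip ip) Tsa. Qed.

Lemma self_adjointI T :
  (forall x y, ip (T x) y = ip x (T y)) -> self_adjoint ip T.
Proof.
move=> Tsym; apply/lfunP => y; apply: (dot_inj (ip := ip)) => x.
by rewrite -(adjointP ip ip) Tsym.
Qed.

Lemma SPD_semiSPD T : SPD ip T -> semiSPD ip T.
Proof.
move=> [Tsa Tpos]; split=> // x; have [->|/Tpos/ltW//] := eqVneq x 0.
by rewrite linear0r.
Qed.

Lemma dot_ge0 x : 0 <= ip x x.
Proof.
have [->|/(@neq0_dnorm_gt0 _ _ _ ip)/ltW//] := eqVneq x 0.
by rewrite linear0r.
Qed.

Lemma quad_nonneg_discr (a b c : R) : 0 <= a -> 0 <= c ->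
  (forall s t, 0 <= s ^+ 2 * a + 2 * s * t * b + t ^+ 2 * c) ->
  b ^+ 2 <= a * c.
Proof.
move=> a0 c0 q; have [c_eq0|c_neq0] := eqVneq c 0.
  (* For [c = 0], this choice of [s] and [t] turns the form into [- b ^+ 2]. *)
  move: (q b (- (a + 1) / 2)); rewrite c_eq0 !mulr0 addr0 => h.
  have b2 : 0 <= b ^+ 2 by exact: sqr_ge0.
  nra.
have c_gt0 : 0 < c by rewrite lt0r c_neq0.
(* At [s = c], [t = - b] the form equals [c * (a * c - b ^+ 2)]. *)
by rewrite -(ler_pM2l c_gt0); move: (q c (- b)); nra.
Qed.

Lemma semiSPD_CauchySchwarz T x y : semiSPD ip T ->
  ip (T x) y ^+ 2 <= ip (T x) x * ip (T y) y.
Proof.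
move=> [Tsa Tge0]; apply: quad_nonneg_discr => // s t.
have -> : s ^+ 2 * ip (T x) x + 2 * s * t * ip (T x) y + t ^+ 2 * ip (T y) y
    = ip (T (s *: x + t *: y)) (s *: x + t *: y).
  rewrite (linearD T) !linearZ_LR !dotDl !dotDr !dotZl !dotZr.
  rewrite (self_adjointE y x Tsa) (dotC ip y (T x)); ring.
exact: Tge0.
Qed.

Lemma dot_CauchySchwarz x y : ip x y ^+ 2 <= ip x x * ip y y.
Proof.
have := @semiSPD_CauchySchwarz \1%VF x y; rewrite !id_lfunE; apply; split.
  by apply: self_adjointI => u v; rewrite !id_lfunE.
by move=> u; rewrite id_lfunE dot_ge0.
Qed.

(** Cauchy-Schwarz against [T x] itself bounds the square of [ip (T x) (T x)] by 0. *)
Lemma semiSPD_eq0 T x : semiSPD ip T -> ip (T x) x = 0 -> T x = 0.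
Proof.
move=> Tsp Tx0; apply: (dot_eq0 (ip := ip)).
apply/eqP; rewrite -sqrf_eq0 eq_le sqr_ge0 andbT.
by rewrite (le_trans (semiSPD_CauchySchwarz x (T x) Tsp))// Tx0 mul0r.
Qed.

(** By Riesz each basis coordinate of [x] is a product [ip x (r i)], so the form is a sum of
    products [p * q] of two functionals of [x], each at most the mean of [p ^+ 2] and [q ^+ 2]. The
    summand 1 only makes the bound positive. *)
Lemma quad_form_bounded T :
  exists2 M, 0 < M & forall x, ip (T x) x <= M * ip x x.
Proof.
pose b := vbasis {:V}.
have coordE (i : 'I_(\dim {:V})) : {r | forall x, coord b i x = ip x r}.
  apply: cid.
  exact: (riesz ip (coord b i : {linear V -> R^o})).
pose r i := sval (coordE i).
pose m i := ip (r i) (r i) + ip (T b`_i) (T b`_i).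
have m_ge0 i : 0 <= m i by rewrite addr_ge0 ?dot_ge0.
exists (1 + \sum_i m i).
  by rewrite ltr_pwDl// sumr_ge0.
move=> x; rewrite [X in T X](coord_vbasis (memvf x)) linear_sum.
under eq_bigr do rewrite linearZ.
rewrite dot_coordl mulrDl mul1r mulr_suml.
rewrite -[leLHS]add0r lerD ?dot_ge0// ler_sum// => i _.
rewrite (svalP (coordE i)) -/(r i) -/b /m.
have := dot_CauchySchwarz x (r i).
have := dot_CauchySchwarz (T b`_i) x.
set p := ip x (r i); set q := ip (T b`_i) x.
have : 0 <= (p - q) ^+ 2 by exact: sqr_ge0.
have := dot_ge0 x; have := dot_ge0 (r i); have := dot_ge0 (T b`_i).
nra.
Qed.

(* Cauchy-Schwarz for the form of [T], applied to [x = T y] and [y], with [y]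
   depending linearly on [x]. *)
Lemma semiSPD_coercive T : semiSPD ip T ->
  exists2 M, 0 < M & forall x, x \in limg T -> ip x x <= M * ip (T x) x.
Proof.
(* On [limg T], [y = T^-1 x] satisfies [T y = x]; bounding the form of [T^-1] then lets one factor
   [ip x x] cancel. *)
move=> Tsp; have [M M0 MP] := quad_form_bounded T^-1%VF.
exists M => // x xT; have := semiSPD_CauchySchwarz (T^-1%VF x) x Tsp.
rewrite (limg_lfunVK xT) (dotC ip x) => CS.
have [->|/(@neq0_dnorm_gt0 _ _ _ ip) x0] := eqVneq x 0.
  by rewrite !linear0r.
rewrite -(ler_pM2r x0); apply: (le_trans CS).
rewrite mulrAC ler_wpM2r//; first by case: Tsp => _; exact.
Qed.

(** The residual is orthogonal to [limg T], which for symmetric [T] means that [T] kills it. *)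
Lemma sub_oproj_lker T x : self_adjoint ip T ->
  x - vsval (oproj ip (limg T) x) \in lker T.
Proof.
move=> Tsa; rewrite memv_ker; apply/eqP/(dot_inj (ip := ip)) => y.
by rewrite linear0r -(self_adjointE _ _ Tsa) dotC oproj_orth// memv_img ?memvf.
Qed.

End SymmetricOperators.

(** * Energy reduction for an abstract error operator [E] *)

Section ErrorReduction.
Context {R : realType} {V W : vectType R}.
Context (ip : {dot V for idfun}) (ipW : {dot W for idfun}).
Context (A E : 'End(V)) (P : 'Hom(W, V)) (P' : 'Hom(V, W)) (C : 'End(W)).
Hypotheses (A_semiSPD : semiSPD ip A) (A_neq0 : A != 0) (C_SPD : SPD ipW C).
Hypothesis P_adj : forall w v, ip (P w) v = ipW w (P' v).
Hypothesis P'A_inj : forall v, P' (A v) = 0 -> A v = 0.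

Let nA v := ip (A v) v.
Let g v := ipW (C (P' (A v))) (P' (A v)).

Hypothesis E_energy : forall v, nA (E v) = nA v - g v.

Let A_sym x y : ip (A x) y = ip x (A y).
Proof. by apply: self_adjointE; case: A_semiSPD. Qed.

Let C_sym x y : ipW (C x) y = ipW x (C y).
Proof. by apply: self_adjointE; case: C_SPD. Qed.

Let nA_ge0 v : 0 <= nA v.
Proof. by case: A_semiSPD => _; exact. Qed.

Let g_ge0 v : 0 <= g v.
Proof. by case: (SPD_semiSPD C_SPD) => _; exact. Qed.

(** Allows any vector to be replaced by its projection onto [limg A], where coercivity is
    available. *)
Lemma energy_congr u v : A u = A v -> nA u = nA v.
Proof. by move=> uv; rewrite /nA uv A_sym uv -A_sym. Qed.

Lemma energyZ (a : R) v : nA (a *: v) = a ^+ 2 * nA v.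
Proof. by rewrite /nA (linearZ_LR A) dotZl dotZr mulrA expr2. Qed.

Lemma decreaseZ (a : R) v : g (a *: v) = a ^+ 2 * g v.
Proof.
rewrite /g (linearZ_LR A) (linearZ_LR P') (linearZ_LR C) dotZl dotZr.
by rewrite mulrA expr2.
Qed.

Lemma projection_energy v : let u := vsval (oproj ip (limg A) v) in
  u \in limg A /\ A u = A v.
Proof.
split; first exact: subvsP.
have := sub_oproj_lker (ip := ip) (T := A) v A_semiSPD.1.
by rewrite memv_ker linearB /= subr_eq0 => /eqP ->.
Qed.

Let G : 'End(V) := (A \o P \o C \o P' \o A)%VF.

Lemma G_formE x y : ip (G x) y = ipW (C (P' (A x))) (P' (A y)).
Proof. by rewrite /G !comp_lfunE A_sym P_adj. Qed.

Lemma G_semiSPD : semiSPD ip G.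
Proof.
split; last by move=> v; rewrite G_formE; exact: g_ge0.
by apply: self_adjointI => x y; rewrite G_formE C_sym dotC -G_formE dotC.
Qed.

(** The form of [G] is [g], which by positivity of [C] and [P'A_inj] vanishes only on [lker A].
    Equal kernels give equal ranks, and [A] is the outermost factor of [G]. *)
Lemma limg_G : limg G = limg A.
Proof.
have kerG : lker G = lker A.
  apply/vspaceP => v; rewrite !memv_ker; apply/eqP/eqP => [Gv|Av].
    apply: P'A_inj; apply/eqP; apply: contraT => /C_SPD.2.
    by rewrite -G_formE Gv linear0l ltxx.
  by rewrite /G !comp_lfunE Av !linear0.
apply/eqP; rewrite eqEdim; apply/andP; split.
  by rewrite /G -!comp_lfunA limg_comp limgS ?subvf.
by rewrite -(leq_add2l (\dim (fullv :&: lker A))) -{2}kerG !limg_ker_dim.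
Qed.

(** For [u] in [limg A = limg G], boundedness of [A] and coercivity of [G] chain to
    [nA u <= M * ip u u <= M * N * g u]. *)
Lemma energy_decrease_coercive : exists2 c, 0 < c & forall v, c * nA v <= g v.
Proof.
have [M M_gt0 MP] := quad_form_bounded ip A.
have [N N_gt0 NP] := semiSPD_coercive G_semiSPD.
exists (M * N)^-1; first by rewrite invr_gt0 mulr_gt0.
move=> v; have [uA uv] := projection_energy v.
set u := vsval _ in uA uv.
rewrite -(energy_congr uv) mulrC ler_pdivrMr ?mulr_gt0//.
rewrite (le_trans (MP u))// [leRHS]mulrC -mulrA ler_pM2l//.
by rewrite /g -uv -G_formE NP// limg_G.
Qed.

Lemma unit_energy_vector : exists2 v, v \in limg A & nA v = 1.
Proof.
have [x Ax] : exists x, A x != 0.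
  apply/not_existsP => A0; move: A_neq0; rewrite (_ : A = 0) ?eqxx//.
  by apply/lfunP => x; rewrite zero_lfunE; apply/eqP/negPn/negP/A0.
have nx : 0 < nA x.
  rewrite lt0r nA_ge0 andbT; apply: contra Ax => /eqP Ax0.
  by apply/eqP/(semiSPD_eq0 A_semiSPD).
have [uA uv] := projection_energy x; set u := vsval _ in uA uv.
exists ((Num.sqrt (nA x))^-1 *: u); first by rewrite memvZ.
rewrite energyZ (energy_congr uv) exprVn sqr_sqrtr ?nA_ge0// mulVf//.
by rewrite gt_eqF.
Qed.

Lemma seminorm_eq1 v : (seminorm ip A v = 1) <-> (nA v = 1).
Proof.
split=> [s1|v1]; last by rewrite /seminorm -/(nA v) v1 sqrtr1.
by rewrite -[LHS]sqr_sqrtr// -[Num.sqrt _]/(seminorm ip A v) s1 expr1n.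
Qed.

Lemma energy_contraction :
  exists2 q, 0 <= q < 1 & forall v, nA (E v) <= q * nA v.
Proof.
have [c c_gt0 cP] := energy_decrease_coercive.
exists (1 - c); last by move=> v; rewrite E_energy mulrBl mul1r lerB.
rewrite gtrBl c_gt0 andbT subr_ge0.
(* A unit vector gives [c <= g v <= 1], since [nA (E v)] is nonnegative; hence [1 - c] is not
   negative. *)
have [v _ v1] := unit_energy_vector.
have := cP v; have := nA_ge0 (E v); rewrite E_energy v1; lra.
Qed.

(** Both forms are homogeneous of degree two; where [nA v = 0] the claim is just [0 <= g v]. *)
Lemma decrease_ge_on_sphere l : (forall v, nA v = 1 -> l <= g v) ->
  forall v, l * nA v <= g v.
Proof.
move=> lP v; have [->|v0] := eqVneq (nA v) 0; first by rewrite mulr0.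
have v_gt0 : 0 < nA v by rewrite lt0r v0 nA_ge0.
have := lP ((Num.sqrt (nA v))^-1 *: v).
rewrite energyZ decreaseZ exprVn sqr_sqrtr ?nA_ge0// mulVf// => /(_ erefl).
by rewrite mulrC ler_pdivlMr.
Qed.

(** With [w = C y], moving [P] and [A] across gives [nA v = ipW (C y) (P' (A v))], to which
    Cauchy-Schwarz for the form of [C] applies. *)
Lemma energy_le_lifting_decrease v w : A (P w) = A v ->
  nA v ^+ 2 <= ipW (C^-1%VF w) w * g v.
Proof.
move=> Pw; pose y := C^-1%VF w.
have Cy : C y = w by rewrite /y -comp_lfunE (SPD_compfV C_SPD) id_lfunE.
have -> : nA v = ipW (C y) (P' (A v)).
  by rewrite Cy -P_adj -A_sym Pw.
rewrite -/y -{1}Cy (dotC ipW y).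
exact: semiSPD_CauchySchwarz (SPD_semiSPD C_SPD).
Qed.

(* The minimizer of [(C^-1 w, w)] under the constraint [A P w = A v] is
   [C P' A z], where [z] solves [A P C P' A z = A v]. *)
Lemma exists_lifting v : exists2 w, A (P w) = A v &
  forall l, 0 < l -> (forall z, l * nA z <= g z) ->
  l * ipW (C^-1%VF w) w <= nA v.
Proof.
have /memv_imgP[z _ Gz] : A v \in limg G by rewrite limg_G memv_img ?memvf.
pose y := P' (A z); exists (C y); first by rewrite Gz /G !comp_lfunE.
move=> l l_gt0 lP.
rewrite -C_sym -[C (C^-1%VF _)]comp_lfunE (SPD_compfV C_SPD) id_lfunE -/(g z).
have gz : g z = ip (A v) z by rewrite Gz G_formE.
have := semiSPD_CauchySchwarz v z A_semiSPD.
rewrite -gz -/(nA v) -/(nA z) => CS.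
have := lP z; have := g_ge0 z; have := nA_ge0 v.
set p := g z in CS *; set a := nA v in CS *; set b := nA z in CS * => a0 p0 lb.
have [->|pn0] := eqVneq p 0; first by rewrite mulr0.
have p_gt0 : 0 < p by rewrite lt0r pn0.
(* After multiplication by [p]: [l * p ^+ 2 <= l * (a * b) <= a * p], from [CS] and [l * b <= p]. *)
rewrite -(ler_pM2r p_gt0) -mulrA -expr2.
by apply: le_trans (_ : l * (a * b) <= _); rewrite ?ler_pM2l// mulrCA ler_wpM2l.
Qed.

Lemma opseminorm_error_sqr :
  let K : \bar R :=
    ereal_sup [set
      ereal_inf [set
        ereal_inf [set (ipW (C^-1%VF w) w)%:E | w in [set w | P w = v + phi]]
      | phi in [set phi | phi \in lker A]]
    | v in [set v | v \in limg A /\ seminorm ip A v = 1]] in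
  (opseminorm ip A E ^+ 2 = 1 - K^-1)%E.
Proof.
move=> K.
(* Upper test for [K]: the lifting [w] of [v] is admissible with [phi = P w - v], which lies in
   [lker A]. *)
have K_le l : 0 < l -> (forall v, nA v = 1 -> l <= g v) -> (K <= l^-1%:E)%E.
  move=> l_gt0 /decrease_ge_on_sphere lP; apply: ge_ereal_sup.
  move=> _ [v [_ /seminorm_eq1 v1] <-].
  have [w Pw wP] := exists_lifting v.
  apply: ge_ereal_inf; exists (ereal_inf
    [set (ipW (C^-1%VF w) w)%:E | w in [set w' | P w' = v + (P w - v)]]).
    by exists (P w - v) => //=; rewrite memv_ker linearB /= Pw subrr.
  apply: ge_ereal_inf; exists (ipW (C^-1%VF w) w)%:E.
    by exists w => //=; rewrite addrC subrK.
  by rewrite lee_fin -[leRHS]mul1r -v1 ler_pdivlMr// mulrC wP.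
have [v0 v0A v01] := unit_energy_vector.
(* Lower test for [K]: [phi] disappears under [A], so all admissible [w] satisfy [A (P w) = A v]. *)
have le_K v l : v \in limg A -> nA v = 1 ->
    (forall w, A (P w) = A v -> l <= ipW (C^-1%VF w) w) -> (l%:E <= K)%E.
  move=> vA v1 lP; apply: le_ereal_sup_tmp; eexists.
    by exists v; first by split => //; apply/seminorm_eq1.
  apply: le_ereal_inf_tmp => _ [phi phiA <-].
  apply: le_ereal_inf_tmp => _ [w Pw <-].
  rewrite lee_fin lP//; move: phiA Pw => /=; rewrite memv_ker => /eqP phi0 ->.
  by rewrite linearD /= phi0 addr0.
have g_le1 v : nA v = 1 -> g v <= 1.
  by move=> v1; have := nA_ge0 (E v); rewrite E_energy v1 subr_ge0.
have [c c_gt0 cP] := energy_decrease_coercive.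
have g_gt0 v : nA v = 1 -> 0 < g v.
  by move=> v1; rewrite (lt_le_trans c_gt0)// -[c]mulr1 -v1 cP.
(* Since [0 < g v0 <= 1], the Cauchy-Schwarz bound forces every lifting of [v0] to cost at least 1.
   This keeps [K] away from 0 and makes [1 - k^-1] nonnegative. *)
have K_ge1 : (1%:E <= K)%E.
  apply: (le_K v0) => // w /energy_le_lifting_decrease.
  rewrite v01 expr1n; have := g_le1 _ v01; have := g_gt0 _ v01; nra.
have K_fin : K \is a fin_num.
  rewrite fin_numE -ltey -ltNye; apply/andP; split.
    by rewrite (lt_le_trans _ K_ge1)// ltNyr.
  rewrite (le_lt_trans (K_le c c_gt0 _)) ?ltry// => v v1.
  by rewrite -[c]mulr1 -v1 cP.
rewrite -(fineK K_fin) in K_le le_K K_ge1 *; move: (fine K) K_le le_K K_ge1.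
move=> k K_le le_K; rewrite lee_fin => k_ge1.
have k_gt0 : 0 < k by lra.
(* Every lifting of [v] costs at least [(g v)^-1]; the projection [u] replaces [v] because [K]
   ranges over [limg A] only. *)
have g_ge v : nA v = 1 -> k^-1 <= g v.
  move=> v1; have [uA uv] := projection_energy v; set u := vsval _ in uA uv.
  have u1 : nA u = 1 by rewrite (energy_congr uv).
  have gu : g u = g v by rewrite /g uv.
  rewrite invf_ple ?posrE ?g_gt0// -lee_fin; apply: (le_K u) => // w.
  move=> /energy_le_lifting_decrease.
  by rewrite u1 expr1n gu -ler_pdivrMr ?g_gt0// mul1r.
set s := opseminorm ip A E.
have s_ge0 : (0 <= s)%E.
  apply: le_ereal_sup_tmp; exists (seminorm ip A (E v0))%:E.
    by exists v0 => //=; apply/seminorm_eq1.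
  by rewrite lee_fin sqrtr_ge0.
have k1 : 0 <= 1 - k^-1 by rewrite subr_ge0 invf_le1.
have s_le : (s <= (Num.sqrt (1 - k^-1))%:E)%E.
  apply: ge_ereal_sup => _ [v /seminorm_eq1 v1 <-].
  by rewrite lee_fin ler_sqrt// -/(nA _) E_energy v1 lerB ?g_ge.
have le_s v : nA v = 1 -> ((Num.sqrt (nA (E v)))%:E <= s)%E.
  move=> v1; apply: ereal_sup_ubound; exists v => //=; exact/seminorm_eq1.
have s_fin : s \is a fin_num by rewrite ge0_fin_numE// (le_lt_trans s_le)// ltry.
rewrite -(fineK s_fin) in s_ge0 s_le le_s *; move: (fine s) s_ge0 s_le le_s.
move=> r; rewrite !lee_fin => r_ge0 r_le le_r.
rewrite inver gt_eqF// -EFin_expe -EFinB; congr EFin; apply/eqP.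
have r2_le : r ^+ 2 <= 1 - k^-1.
  by rewrite -(sqr_sqrtr k1) ler_sqr ?nnegrE ?sqrtr_ge0.
rewrite eq_le r2_le /=.
have kV_gt0 : 0 < k^-1 by rewrite invr_gt0.
have r2_lt1 : 0 < 1 - r ^+ 2 by lra.
(* The goal becomes [k <= (1 - r ^+ 2)^-1], and [K_le] applies because [1 - r ^+ 2] bounds [g] from
   below on the sphere. *)
rewrite lerBlDr -lerBlDl -lef_pV2 ?posrE// invrK -lee_fin; apply: K_le => // v v1.
have := le_r v v1; rewrite lee_fin -ler_sqr ?nnegrE ?sqrtr_ge0// sqr_sqrtr//.
by rewrite E_energy v1; lra.
Qed.

(** The energy decays like [q ^+ m], projecting onto [limg A] preserves it, and there it controls
    the norm by coercivity of [A]. *)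
Lemma energy_iterate_cvg e0 :
  dotnorm ip (vsval (oproj ip (limg A) (iter m E e0))) @[m --> \oo] --> (0 : R).
Proof.
have [q /andP[q_ge0 q_lt1] qP] := energy_contraction.
have [M M_gt0 MP] := semiSPD_coercive A_semiSPD.
have iter_le m : nA (iter m E e0) <= q ^+ m * nA e0.
  elim: m => [|m IH]; first by rewrite expr0 mul1r.
  by rewrite (le_trans (qP _))// exprS -mulrA ler_wpM2l.
have bound m : 0 <= dotnorm ip (vsval (oproj ip (limg A) (iter m E e0)))
    <= Num.sqrt q ^+ m * Num.sqrt (M * nA e0).
  rewrite sqrtr_ge0 /=; have [uA uv] := projection_energy (iter m E e0).
  set u := vsval _ in uA uv *.
  have -> : Num.sqrt q ^+ m = Num.sqrt (q ^+ m).
    by elim: m {iter_le u uA uv} => [|m IH]; rewrite ?sqrtr1// !exprS sqrtrM// IH.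
  rewrite -sqrtrM ?exprn_ge0// ler_wsqrtr// (le_trans (MP _ uA))//.
  by rewrite -/(nA u) (energy_congr uv) mulrCA ler_pM2l.
apply: (squeeze_cvgr (nearW _ bound)); first exact: cvg_cst.
rewrite -[X in _ --> X](mul0r (Num.sqrt (M * nA e0))); apply: cvgMl.
apply: cvg_expr.
by rewrite ger0_norm ?sqrtr_ge0// -sqrtr1 ltr_sqrt ?ltr01.
Qed.

End ErrorReduction.

(** * Specialization to [P = Pi \o embed Wt], [P' = Qt \o Pi'], [C = Bbar] *)

Theorem theorem5p3 (R : realType) (V Vt : vectType R)
    (ip : {dot V for idfun}) (ipt : {dot Vt for idfun})
    (A : 'End(V)) (f : V) (Pi : 'Hom(Vt, V)) (Bt : 'End(Vt))
    (Wt : {vspace Vt}) :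
  semiSPD ip A -> A != 0 -> f \in limg A -> limg Pi = fullv ->
  let At : 'End(Vt) := (adjoint ipt ip Pi \o A \o Pi)%VF in
  let B : 'End(V) := (Pi \o Bt \o adjoint ipt ip Pi)%VF in
  let Qt : 'Hom(Vt, subvs_of Wt) := oproj ipt Wt in
  let Bt' : 'End(Vt) := adjoint ipt ipt Bt in
  let Bbar : 'End(subvs_of Wt) :=
    (Qt \o (Bt + Bt' - (Bt' \o At \o Bt)%VF)%R \o embed Wt)%VF in
  (limg At <= Wt)%VS ->
  SPD (subdot ipt Wt) Bbar ->
  let K : \bar R :=
    ereal_sup [set
      ereal_inf [set
        ereal_inf [set (subdot ipt Wt ((Bbar^-1)%VF w) w)%:E
                  | w in [set w : subvs_of Wt | Pi (vsval w) = v + phi]]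
      | phi in [set phi | phi \in lker A]]
    | v in [set v | v \in limg A /\ seminorm ip A v = 1]] in
  converges ip A f (iterate A B f) /\
  (opseminorm ip A (\1%VF - (B \o A)%VF)%R ^+ 2 = 1 - K^-1)%E.
Proof.
move=> A_sp A_neq0 fA Pi_surj At B Qt Bt' Bbar AtW Bbar_SPD K.
pose Pi' := adjoint ipt ip Pi.
pose E : 'End(V) := (\1%VF - (B \o A)%VF)%R.
have EE v : E v = v - B (A v).
  by rewrite /E add_lfunE opp_lfunE id_lfunE comp_lfunE.
have A_sym x y : ip (A x) y = ip x (A y) by apply: self_adjointE; case: A_sp.
(* Surjectivity writes [v = Pi x], so that [Pi' (A v) = At x]. *)
have PiA_W v : Pi' (A v) \in Wt.
  have /memv_imgP[x _ ->] : v \in limg Pi by rewrite Pi_surj memvf.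
  by rewrite -!comp_lfunE; apply: (subvP AtW); rewrite memv_img ?memvf.
have Qt_id x : x \in Wt -> vsval (Qt x) = x.
  move=> xW; apply/eqP; rewrite -subr_eq0 -oppr_eq0 opprB; apply/eqP.
  by apply: (dot_eq0 (ip := ipt)); rewrite oproj_orth// memvB ?subvsP.
have Qt_adj x (w : subvs_of Wt) : ipt x (vsval w) = subdot ipt Wt (Qt x) w.
  by apply/eqP; rewrite -subr_eq0 -dotBl oproj_orth ?subvsP.
have PE w : (Pi \o embed Wt)%VF w = Pi (vsval w) by rewrite comp_lfunE lfunE.
have P'E v : (Qt \o Pi')%VF v = Qt (Pi' v) by exact: comp_lfunE.
have P_adj w v : ip ((Pi \o embed Wt)%VF w) v
    = subdot ipt Wt w ((Qt \o Pi')%VF v).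
  by rewrite PE P'E (adjointP ipt ip) dotC Qt_adj; exact: (dotC ipt).
(* [Qt] fixes [Pi' (A v)], so this vector vanishes; with [A v = Pi x], [A v] is then orthogonal to
   itself. *)
have P'A_inj v : (Qt \o Pi')%VF (A v) = 0 -> A v = 0.
  rewrite P'E => /(congr1 vsval); rewrite Qt_id// linear0 => PiAv.
  have /memv_imgP[x _ Ax] : A v \in limg Pi by rewrite Pi_surj memvf.
  apply: (dot_eq0 (ip := ip)).
  by rewrite {1}Ax (adjointP ipt ip) -/Pi' PiAv linear0r.
(* With [t = Pi' (A v)], which [Qt] fixes, the terms in [Bt] and [Bt'] give the two cross terms of
   the energy of [v - B (A v)], and the term in [At] gives the energy of [B (A v)]. *)
have E_energy v : ip (A (E v)) (E v) = ip (A v) v -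
    subdot ipt Wt (Bbar ((Qt \o Pi')%VF (A v))) ((Qt \o Pi')%VF (A v)).
  have Pi_adj x y : ip (Pi x) y = ipt x (Pi' y) by exact: adjointP.
  have Bt_adj x y : ipt (Bt x) y = ipt x (Bt' y) by exact: adjointP.
  pose t := Pi' (A v).
  have tW : vsval (Qt t) = t by rewrite Qt_id ?PiA_W.
  rewrite P'E -/t [Bbar _]comp_lfunE [X in subdot _ _ X _]comp_lfunE -Qt_adj.
  rewrite [embed Wt _]lfunE /= tW.
  have -> : (Bt + Bt' - (Bt' \o At \o Bt)%VF) t = Bt t + Bt' t - Bt' (At (Bt t)).
    by rewrite !add_lfunE opp_lfunE !comp_lfunE.
  rewrite dotBl dotDl [ipt (Bt' t) t]dotC [ipt (Bt' (At _)) t]dotC -!Bt_adj.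
  have -> : ipt (Bt t) (At (Bt t)) = ip (A (B (A v))) (B (A v)).
    by rewrite /At /B !comp_lfunE -/Pi' -/t -Pi_adj dotC.
  have Btt : ipt (Bt t) t = ip (A v) (B (A v)).
    by rewrite /B !comp_lfunE -/Pi' -/t [RHS]dotC Pi_adj.
  rewrite Btt EE (linearB A) !dotBl !dotBr [ip (A (B _)) v]A_sym.
  by rewrite [ip (B _) (A v)]dotC; ring.
split; last first.
  have := opseminorm_error_sqr A_sp A_neq0 Bbar_SPD P_adj P'A_inj E_energy.
  rewrite /K => ->; congr (_ - (ereal_sup _)^-1)%E.
  congr image; apply/funext => v; congr ereal_inf; congr image.
  apply/funext => phi; congr ereal_inf; congr image.
  by apply/funext => w /=; rewrite PE.
move=> u0 u Au.
(* As [f = A u], the error is multiplied by [E] at each step. *)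
have iterE m : iterate A B f u0 m - u = iter m E (u0 - u).
  elim: m => // m IH; rewrite [RHS]iterS -IH EE /=.
  have -> : A (iterate A B f u0 m - u) = A (iterate A B f u0 m) - f.
    by rewrite -Au; exact: linearB.
  by rewrite -[f - _]opprB (linearN B) addrAC.
have := energy_iterate_cvg A_sp A_neq0 Bbar_SPD P_adj P'A_inj E_energy (u0 - u).
by under eq_fun do rewrite -iterE !linearB.
Qed.
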